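(* Let $n\geq 2$ and $1\leq p\leq\infty$. The normed linear space $(\mathbb{R}^n,\|\cdot\|_p)$ is an inner product space, i.e. $p=2$, if and only if for every element $x$ on its unit sphere (i.e. with $\|x\|_p=1$) there exists a strongly orthonormal Hamel basis of $(\mathbb{R}^n,\|\cdot\|_p)$ in the sense of Birkhoff-James containing $x$.
   Context: $\|\cdot\|_p$ denotes the usual $\ell_p$ norm on $\mathbb{R}^n$. A finite set $\{x_1,\ldots,x_m\}$ in a real normed linear space is a strongly orthogonal set in the sense of Birkhoff-James if for each $i\in\{1,\ldots,m\}$ one has $\|x_i\|<\left\|x_i+\sum_{j\neq i}\lambda_jx_j\right\|$ for all real scalars $\lambda_j$ ($j\neq i$) that are not all $0$. It is strongly orthonormal if moreover all its elements have norm $1$. A strongly orthonormal Hamel basis is a (vector space) basis that is a strongly orthonormal set. *)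

(* Defs.v *)
From HB Require Import structures.
From mathcomp Require Import all_boot all_order all_algebra.
From mathcomp Require Import all_classical all_reals all_analysis.

Set Implicit Arguments.
Unset Strict Implicit.
Unset Printing Implicit Defensive.

Import Order.TTheory GRing.Theory Num.Theory.

Local Open Scope ring_scope.

(* Norms are passed as explicit functions N : V -> R because 'rV[R]_n already
   carries a canonical norm (the maximum norm). *)

(* The value at p = -oo is junk. *)
Definition lpnorm (R : realType) (n : nat) (p : \bar R) (x : 'rV[R]_n) : R :=
  match p with
  | EFin r => (\sum_(i < n) `|x ord0 i| `^ r) `^ r^-1
  | +oo%E => \big[Num.max/0]_(i < n) `|x ord0 i|
  | -oo%E => 0
  end.

(* A finite set is given by a duplicate-free enumeration X of its elements. *)
Definition strongly_orthogonal (R : realType) (V : lmodType R) (N : V -> R)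
    (X : seq V) : Prop :=
  uniq X /\
  forall (i : 'I_(size X)) (lam : 'I_(size X) -> R),
    (exists2 j, j != i & lam j != 0) ->
    N X`_i < N (X`_i + \sum_(j < size X | j != i) lam j *: X`_j).

Definition strongly_orthonormal (R : realType) (V : lmodType R) (N : V -> R)
    (X : seq V) : Prop :=
  strongly_orthogonal N X /\ {in X, forall v, N v = 1}.

Definition strongly_orthonormal_Hamel_basis (R : realType) (V : vectType R)
    (N : V -> R) (X : seq V) : Prop :=
  basis_of fullv X /\ strongly_orthonormal N X.

(* {dot V for idfun} is the type of symmetric positive definite bilinear forms
   on V, since the involution is the identity of R. *)
Definition inner_product_norm (R : realType) (V : lmodType R) (N : V -> R) :
    Prop :=
  exists dot : {dot V for idfun}, forall v, N v ^+ 2 = dot v v.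

(* Main.v *)
Require Import Defs.
From HB Require Import structures.
From mathcomp Require Import all_boot all_order all_algebra.
From mathcomp Require Import ring lra.
From mathcomp Require Import all_classical all_reals all_analysis.

Set Implicit Arguments.
Unset Strict Implicit.
Unset Printing Implicit Defensive.

Import Order.TTheory GRing.Theory Num.Theory.
Import numFieldNormedType.Exports.

Local Open Scope ring_scope.


(** For p = 1 and p = oo the unit vectors (1/2, 1/2, 0, ...) and (1, 0, ...)
    are not exposed points of the unit ball, while a member of a strongly
    orthonormal basis must be one.  For 1 < p < oo the norm is differentiable,
    so two members x and y satisfy J(x).y = 0 = J(y).x, where
    J(z)_k = sg(z_k) |z_k|^(p-1); for x proportional to (1, 2, 0, ...) this
    forces p = 2.  For p = 2 a Householder reflection sends e_0 to any given
    unit vector, and its rows are the required basis.  Finally, the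
    parallelogram law at e_0 and e_1 singles out p = 2. *)

(** * Strong orthogonality and exposed points, for a general norm function *)

Section BirkhoffJames.
Context {R : realType} {V : vectType R} (N : V -> R).

Lemma strongly_orthogonal_ltZ (X : seq V) (i j : 'I_(size X)) (t : R) :
  strongly_orthogonal N X -> j != i -> t != 0 ->
  N X`_i < N (X`_i + t *: X`_j).
Proof.
move=> [_ XN] ji t0.
have := XN i (fun k => if k == j then t else 0).
rewrite (bigD1 j) //= eqxx big1 ?addr0; first by apply; exists j; rewrite ?eqxx.
by move=> k /andP[_ /negPf ->]; rewrite scale0r.
Qed.

Lemma basis_decomp (X : seq V) (i : 'I_(size X)) (v : V) :
  basis_of fullv X -> exists a (c : 'I_(size X) -> R),
  v = a *: X`_i + \sum_(j < size X | j != i) c j *: X`_j.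
Proof.
move=> /span_basis XV; have vX : v \in <<in_tuple X>>%VS by rewrite XV memvf.
exists (coord (in_tuple X) i v), (fun j => coord (in_tuple X) j v).
by rewrite [LHS](coord_span vX) (bigD1 i).
Qed.

(* The hyperplane spanned by the other members of X supports the ball through x
   only at x, so x is not the midpoint of a segment contained in that ball. *)
Lemma strongly_orthogonal_exposed (X : seq V) (x d : V) :
  (forall v, 0 <= N v) -> (forall a v, N (a *: v) = `|a| * N v) ->
  basis_of fullv X -> strongly_orthogonal N X -> x \in X ->
  N (x + d) <= N x -> N (x - d) <= N x -> exists a, d = a *: x.
Proof.
move=> N0 NZ bX [_ XN] /(nthP 0)[k kX <-{x}].
pose i := Ordinal kX; rewrite -[k]/(val i) => Np Nm.
have [a [c dE]] := basis_decomp i d bX.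
have [/existsP[j /andP[ji cj]]|/existsPn c0] :=
    boolP [exists j, (j != i) && (c j != 0)]; last first.
  exists a; rewrite dE big1 ?addr0// => j ji.
  by have := c0 j; rewrite ji negbK => /eqP ->; rewrite scale0r.
(* Dividing by 1 + t a >= 1 leaves the member plus a nontrivial combination of the others, which is
   strictly longer; multiplying back cannot shorten it. *)
have key t : t != 0 -> 0 <= t * a -> N X`_i < N (X`_i + t *: d).
  move=> t0 ta0; have s1 : 1 <= 1 + t * a by rewrite lerDl.
  have s0 : 0 < 1 + t * a by exact: lt_le_trans s1.
  have -> : X`_i + t *: d = (1 + t * a) *:
      (X`_i + \sum_(j < size X | j != i) (t / (1 + t * a) * c j) *: X`_j).
    under eq_bigr do rewrite -scalerA.
    rewrite -scaler_sumr scalerDr scalerA mulrCA divff ?gt_eqF// mulr1.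
    by rewrite dE scalerDr scalerA scalerDl scale1r addrA.
  rewrite NZ gtr0_norm//; apply: (@le_lt_trans _ _ ((1 + t * a) * N X`_i)).
    by rewrite ler_peMl.
  rewrite ltr_pM2l//; apply: XN; exists j => //.
  by rewrite mulf_neq0 ?mulf_neq0 ?invr_eq0 ?(gt_eqF s0).
(* The sign t = 1 or t = -1 is chosen so that t a >= 0; each choice contradicts one of the two
   bounds. *)
have [a0|a0] := leP 0 a.
  by have := key 1 (oner_neq0 _); rewrite mul1r scale1r ltNge Np => /(_ a0).
have := key (-1); rewrite mulN1r scaleN1r ltNge Nm oppr_eq0 oner_eq0 oppr_ge0.
by rewrite ltW// => /(_ isT isT).
Qed.

End BirkhoffJames.

(** * The p-norms on planar vectors, and the parallelogram law *)

Section LpNorm.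
Context {R : realType}.
Implicit Types (p : \bar R) (r s t : R).

Lemma lpnorm_ge0 n p (x : 'rV[R]_n) : 0 <= lpnorm p x.
Proof.
case: p => [r| |]//=; first exact: powR_ge0.
by elim/big_ind: _ => // a b a0 b0; rewrite le_max a0.
Qed.

Lemma lpnormZ n p a (x : 'rV[R]_n) : (1 <= p)%E ->
  lpnorm p (a *: x) = `|a| * lpnorm p x.
Proof.
case: p => [r| |]//= r1.
  have r0 : r != 0 by rewrite gt_eqF// (lt_le_trans ltr01).
  under eq_bigr do rewrite mxE normrM powRM//.
  rewrite -mulr_sumr powRM ?powR_ge0//; last first.
    by rewrite sumr_ge0// => i _; exact: powR_ge0.
  by rewrite -powRrM divff// powRr1.
elim/big_ind2: _ => [|u u' v v' -> ->|i _]; first by rewrite mulr0.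
  by rewrite maxr_pMr.
by rewrite mxE normrM.
Qed.

Definition vec2 m (a b : R) : 'rV[R]_m.+2 :=
  \row_j (if j == ord0 then a else if j == lift ord0 ord0 then b else 0).

Lemma vec2_0 m a b : vec2 m a b ord0 ord0 = a.
Proof. by rewrite mxE eqxx. Qed.

Lemma vec2_1 m a b : vec2 m a b ord0 (lift ord0 ord0) = b.
Proof. by rewrite mxE eqxx. Qed.

Lemma vec2D m a b c d : vec2 m a b + vec2 m c d = vec2 m (a + c) (b + d).
Proof.
by apply/rowP => j; rewrite !mxE; do 2?case: ifP => // _; rewrite addr0.
Qed.

Lemma vec2Z m k a b : k *: vec2 m a b = vec2 m (k * a) (k * b).
Proof.
by apply/rowP => j; rewrite !mxE; do 2?case: ifP => // _; rewrite mulr0.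
Qed.

Lemma vec2B m a b c d : vec2 m a b - vec2 m c d = vec2 m (a - c) (b - d).
Proof. by rewrite -scaleN1r vec2Z vec2D !mulN1r. Qed.

(** [F] may depend on the index, so that pairings of [vec2 m a b] with an arbitrary vector are
    covered. *)
Lemma sum_vec2 m a b (F : 'I_m.+2 -> R -> R) : (forall i, F i 0 = 0) ->
  \sum_i F i (vec2 m a b ord0 i) = F ord0 a + F (lift ord0 ord0) b.
Proof.
move=> F0; rewrite !big_ord_recl vec2_0 vec2_1 big1 ?addr0// => i _.
by rewrite mxE /= F0.
Qed.

Lemma lpnorm_vec2 m r a b : r != 0 ->
  lpnorm r%:E (vec2 m a b) = (`|a| `^ r + `|b| `^ r) `^ r^-1.
Proof.
move=> r0; rewrite /= (@sum_vec2 _ _ _ (fun=> fun x => `|x| `^ r))//.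
by move=> _; rewrite normr0 powR0.
Qed.

Lemma lpnorm_oo_vec2 m a b : lpnorm +oo%E (vec2 m a b) = Num.max `|a| `|b|.
Proof.
rewrite /= !big_ord_recl vec2_0 vec2_1.
under eq_bigr do rewrite mxE/= normr0.
by rewrite big_const_ord iter_fix ?maxxx// [Num.max `|b| 0]max_l.
Qed.

(** At e_0 and e_1 the parallelogram law reads (2^(1/r))^2 = 2 for a finite exponent r, and 2 = 4
    for the maximum norm. *)
Lemma inner_product_lpnorm_eq2 m p : (1 <= p)%E ->
  inner_product_norm (@lpnorm R m.+2 p) -> p = 2%:E.
Proof.
move=> p1 [dot Ndot].
have : lpnorm p (vec2 m 1 1) ^+ 2 + lpnorm p (vec2 m 1 (-1)) ^+ 2 =
    (lpnorm p (vec2 m 1 0) ^+ 2 + lpnorm p (vec2 m 0 1) ^+ 2) *+ 2.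
  have -> : vec2 m 1 1 = vec2 m 1 0 + vec2 m 0 1 by rewrite vec2D add0r addr0.
  have -> : vec2 m 1 (-1) = vec2 m 1 0 - vec2 m 0 1.
    by rewrite vec2B subr0 sub0r.
  by rewrite !Ndot !linearDl !linearDr !linearNl !linearNr; ring.
case: p p1 {Ndot} => [r| |]//; rewrite ?lee_fin => r1.
  have r0 : r != 0 by rewrite gt_eqF// (lt_le_trans ltr01).
  rewrite !lpnorm_vec2// normrN normr0 normr1 powR0// powR1 addr0 add0r !powR1.
  rewrite expr1n -mulr2n => /eqP; rewrite eqrMn2r//= => /eqP.
  rewrite -powR_mulrn ?powR_ge0// -powRrM => /(congr1 (@ln R)).
  rewrite ln_powR => /eqP; rewrite -subr_eq0 -{2}[ln 2]mul1r -mulrBl mulf_eq0.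
  rewrite [ln _ == 0]gt_eqF ?ln_gt0 ?(ltr1n R 2)// orbF subr_eq0 mulrC.
  move=> /eqP r2.
  by rewrite -(divfK r0 2) r2 mul1r.
rewrite !lpnorm_oo_vec2 normrN normr0 normr1 maxxx (max_l ler01) (max_r ler01).
by rewrite expr1n => /eqP; rewrite -mulr2n -mulrnA eqr_nat.
Qed.


(** * Differentiation of the norm for r > 1; [sgpow r] is the map J, coordinatewise *)

Definition sgpow r s : R := Num.sg s * `|s| `^ (r - 1).

Lemma sgpowN r s : sgpow r (- s) = - sgpow r s.
Proof. by rewrite /sgpow sgrN normrN mulNr. Qed.

Lemma sgpowM r s t : sgpow r (s * t) = sgpow r s * sgpow r t.
Proof. by rewrite /sgpow sgrM normrM powRM// mulrACA. Qed.

Lemma sgpow0 r : sgpow r 0 = 0.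
Proof. by rewrite /sgpow sgr0 mul0r. Qed.

Lemma sgpow_gt0 r s : 0 < s -> sgpow r s = s `^ (r - 1).
Proof. by move=> s0; rewrite /sgpow gtr0_sg// gtr0_norm// mul1r. Qed.

Lemma sgpow_eq0 r s : (sgpow r s == 0) = (s == 0).
Proof.
rewrite /sgpow mulf_eq0 sgr_eq0 powR_eq0 normr_eq0.
by case: eqP.
Qed.

Lemma is_derive_norm_powR r s : 1 < r ->
  is_derive s 1 (fun x => `|x| `^ r) (r * sgpow r s).
Proof.
move=> r1; have [s0|s0|->] := ltgtP s 0.
- apply: (@near_eq_is_derive _ _ _ ((@powR R ^~ r) \o -%R)).
    near=> x; rewrite /= ltr0_norm//; near: x; exact: lt_nbhsl.
  rewrite -[s]opprK sgpowN sgpow_gt0 ?oppr_gt0// mulrN -mulrN1.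
  apply: is_derive1_comp.
  by rewrite opprK; apply: is_derive1_powR; rewrite oppr_gt0.
- apply: (@near_eq_is_derive _ _ _ (@powR R ^~ r)).
    near=> x; rewrite /= gtr0_norm//; near: x; exact: lt_nbhsr.
  by rewrite sgpow_gt0//; exact: is_derive1_powR.
- have r0 : r != 0 by rewrite gt_eqF// (lt_trans ltr01).
  rewrite sgpow0 mulr0.
  (* The quotient has absolute value |h|^(r-1), which is below e as soon as |h| < e^(1/(r-1)). *)
  have cv : (h^-1 *: (`|h + 0| `^ r - `|0 : R| `^ r) @[h --> 0^']
      --> (0 : R))%classic.
    apply/cvgr0Pnorm_lt => e e0; near=> h.
    have h0 : 0 < `|h| by rewrite normr_gt0; near: h; exact: nbhs_dnbhs_neq.
    rewrite addr0 normr0 powR0// subr0 normrZ normfV norm_powR// normr_id.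
    rewrite -(mulr_powRB1 (ltW h0)) ?(lt_trans ltr01)// mulKf ?gt_eqF//.
    have q0 : 0 < r - 1 by rewrite subr_gt0.
    have -> : e = (e `^ (r - 1)^-1) `^ (r - 1).
      by rewrite -powRrM mulVf ?gt_eqF// powRr1// ltW.
    apply: gt0_ltr_powR; rewrite ?nnegrE ?powR_ge0//.
    near: h; apply: dnbhs0_lt; exact: powR_gt0.
  split; last first.
    by apply/cvg_lim => //; under eq_cvg do rewrite /= [_%:A]mulr1; exact: cv.
  by apply/cvg_ex; exists 0; under eq_cvg do rewrite /= [_%:A]mulr1; exact: cv.
Unshelve. all: by end_near. Qed.

(** The r-th power of the norm of x + t y is differentiable in t and minimal at t = 0, where its
    derivative is r times the sum. *)
Lemma lpnorm_orthogonal n r (x y : 'rV[R]_n) : 1 < r ->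
  (forall t, lpnorm r%:E x <= lpnorm r%:E (x + t *: y)) ->
  \sum_i sgpow r (x ord0 i) * y ord0 i = 0.
Proof.
move=> r1 xy; have r0 : 0 < r by exact: lt_trans r1.
pose f i t := `|x ord0 i + t * y ord0 i| `^ r.
have df i t : is_derive t 1 (f i)
    (r * sgpow r (x ord0 i + t * y ord0 i) * y ord0 i).
  apply: (@is_derive1_comp _ (fun x => `|x| `^ r)
                             (fun t => x ord0 i + t * y ord0 i)).
    exact: is_derive_norm_powR.
  have -> : (fun t => x ord0 i + t * y ord0 i) =
      cst (x ord0 i) + y ord0 i *: (@id R).
    by apply/funext => u /=; rewrite mulrC.
  rewrite -[X in is_derive _ _ _ X]add0r -[X in 0 + X]mulr1.
  by apply: is_deriveD; exact: is_deriveZ.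
have dF t : is_derive t 1 (\sum_i f i)
    (\sum_i r * sgpow r (x ord0 i + t * y ord0 i) * y ord0 i).
  exact: is_derive_sum.
have FE t : (\sum_i f i) t = \sum_i `|(x + t *: y) ord0 i| `^ r.
  by rewrite fct_sumE; apply: eq_bigr => i _; rewrite !mxE.
have sum0 (z : 'rV[R]_n) : 0 <= \sum_i `|z ord0 i| `^ r.
  by rewrite sumr_ge0// => i _; exact: powR_ge0.
have F0 : is_derive (0 : R) 1 (\sum_i f i) 0.
  apply: (@derive1_at_min _ _ (-1) 1) => [|t _||t _].
  - by lra.
  - by have [] := dF t.
  - by rewrite in_itv/= ltrN10 ltr01.
  (* Minimality passes from the norm to its r-th power because s^(1/r) is strictly increasing on s
     >= 0. *)
  rewrite !FE scale0r addr0 leNgt; apply/negP => lt.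
  have := xy t; rewrite leNgt => /negP; apply.
  by apply: gt0_ltr_powR => //; rewrite ?invr_gt0// nnegrE.
have [_] := dF 0; have [_ ->] := F0 => /esym.
under eq_bigr do rewrite mul0r addr0 -mulrA.
by rewrite -mulr_sumr => /eqP; rewrite mulf_eq0 gt_eqF//= => /eqP.
Qed.

Lemma vec2_inj m a b c d : vec2 m a b = vec2 m c d -> a = c /\ b = d.
Proof.
by move=> /rowP E; split; [have := E ord0|have := E (lift ord0 ord0)];
  rewrite ?vec2_0 ?vec2_1.
Qed.

(** * Unit vectors lying in no strongly orthonormal basis when p is not 2 *)

Definition basis_through m p (x : 'rV[R]_m.+2) := exists X : seq 'rV[R]_m.+2,
  strongly_orthonormal_Hamel_basis (lpnorm p) X /\ x \in X.

(** The vector is the midpoint of the segment from (1, -1) to (1, 1) in the unit sphere. *)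
Lemma no_basis_oo m : ~ basis_through +oo%E (vec2 m 1 0).
Proof.
move=> [X [[bX [oX _]] xX]].
have [||||a] := strongly_orthogonal_exposed (d := vec2 m 0 1) _ _ bX oX xX.
- exact: lpnorm_ge0.
- by move=> a v; rewrite lpnormZ// leey.
- by rewrite vec2D !lpnorm_oo_vec2 !addr0 add0r normr0 normr1 maxxx max_l.
- rewrite vec2B !lpnorm_oo_vec2 !subr0 sub0r normrN normr0 normr1 maxxx.
  by rewrite max_l.
by rewrite vec2Z mulr0 => /vec2_inj[_ /eqP]; rewrite oner_eq0.
Qed.

(** The vector is the midpoint of the segment from (0, 1) to (1, 0) in the unit sphere. *)
Lemma no_basis_1 m : ~ basis_through 1%:E (vec2 m 2^-1 2^-1).
Proof.
move=> [X [[bX [oX _]] xX]].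
have N1 a b : lpnorm 1%:E (vec2 m a b) = `|a| + `|b|.
  by rewrite lpnorm_vec2 ?oner_eq0// invr1 !powRr1// addr_ge0.
have half : 0 <= 2^-1 :> R by rewrite invr_ge0.
have [||||a] :=
    strongly_orthogonal_exposed (d := vec2 m 2^-1 (- 2^-1)) _ _ bX oX xX.
- exact: lpnorm_ge0.
- by move=> a v; rewrite lpnormZ.
- by rewrite vec2D !N1 subrr normr0 addr0 !ger0_norm// addr_ge0.
- by rewrite vec2B !N1 subrr normr0 opprK add0r !ger0_norm// addr_ge0.
rewrite vec2Z => /vec2_inj[h1 h2].
have : 2^-1 != 0 :> R by rewrite invr_eq0.
lra.
Qed.

(* Write x = (c, 2c, 0, ..., 0).  For another member y of the basis,
   J(x).y = 0 = J(y).x reads y_0 = - 2^(r-1) y_1 and J(y)_0 = - 2 J(y)_1, whence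
   y_0 = y_1 = 0 unless (r-1)^2 = 1.  But then all the members have their first
   two coordinates proportional to (1, 2). *)
Lemma basis_through_eq2 m r (c : R) : 1 < r -> 0 < c ->
  basis_through r%:E (vec2 m c (2 * c)) -> r = 2.
Proof.
move=> r1 c0 [X [[bX [oX _]]] /(nthP 0)[k kX]].
pose i := Ordinal kX; rewrite -[k]/(val i) => Xi.
have [//|r2] := eqVneq r 2; exfalso.
have orth (h l : 'I_(size X)) : l != h ->
    \sum_j sgpow r (X`_h ord0 j) * X`_l ord0 j = 0.
  move=> lh; apply: (@lpnorm_orthogonal _ r X`_h X`_l r1) => t.
  have [->|t0] := eqVneq t 0; first by rewrite scale0r addr0.
  exact/ltW/strongly_orthogonal_ltZ.
have sc0 : sgpow r c != 0 by rewrite sgpow_eq0 gt_eqF.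
have zero j : j != i ->
    X`_j ord0 ord0 = 0 /\ X`_j ord0 (lift ord0 ord0) = 0.
  move=> ji; have := orth i j ji; have := orth j i; rewrite eq_sym => /(_ ji).
  rewrite Xi (sum_vec2 _ _ (F := fun k a => sgpow r (X`_j ord0 k) * a)).
  2: by move=> ?; rewrite mulr0.
  rewrite (sum_vec2 _ _ (F := fun k a => sgpow r a * X`_j ord0 k)).
  2: by move=> ?; rewrite sgpow0 mul0r.
  set u := X`_j ord0 ord0; set v := X`_j ord0 (lift ord0 ord0).
  rewrite sgpowM mulrA -mulrDl => /eqP.
  rewrite mulf_eq0 (gt_eqF c0) orbF => /eqP B.
  rewrite [sgpow r 2 * _]mulrC -[_ * _ * v]mulrA -mulrDr => /eqP.
  rewrite mulf_eq0 (negPf sc0)/= addr_eq0 => /eqP A.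
  suff v0 : v = 0 by rewrite A v0 mulr0 oppr0.
  apply/eqP; rewrite -(sgpow_eq0 r); move: B => /eqP.
  rewrite A sgpowN sgpowM [_ * 2]mulrC -mulNr -mulrDl mulf_eq0 => /orP[|//].
  (* The factor to be excluded says 2 = 2^((r-1)^2); logarithms turn this into r (r - 2) = 0. *)
  rewrite addrC subr_eq0 [sgpow r 2]sgpow_gt0// sgpow_gt0 ?powR_gt0// -powRrM.
  move=> /eqP.
  rewrite -{1}[2]powRr1// => /(congr1 (@ln R)); rewrite !ln_powR => /eqP.
  have ln2 : ln 2 != 0 :> R by rewrite gt_eqF// ln_gt0// ltr1n.
  rewrite (inj_eq (mulIf ln2)) => /eqP rr.
  have : (r - 2) * r = 0 by move: rr; lra.
  move/eqP; rewrite mulf_eq0 subr_eq0 (negPf r2) gt_eqF//.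
  exact: lt_trans r1.
(* When e_0 is expanded, only the member (c, 2c, 0, ...) reaches the first two coordinates, so 1 = a
   c and 0 = 2 a c. *)
have [a [d dE]] := basis_decomp i (vec2 m 1 0) bX.
have sum0 l : (forall j, j != i -> X`_j ord0 l = 0) ->
    (vec2 m 1 0) ord0 l = a * vec2 m c (2 * c) ord0 l.
  move=> Z; rewrite dE Xi !mxE summxE big1 ?addr0// => j ji.
  by rewrite mxE Z// mulr0.
have := sum0 (lift ord0 ord0) (fun j ji => (zero j ji).2).
have := sum0 ord0 (fun j ji => (zero j ji).1).
rewrite !vec2_0 !vec2_1 => ac /esym/eqP.
rewrite mulrCA -ac mulr1 => /eqP; lra.
Qed.

Lemma basis_through_unit_eq2 m p : (1 <= p)%E ->
  (forall x : 'rV[R]_m.+2, lpnorm p x = 1 -> basis_through p x) -> p = 2%:E.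
Proof.
case: p => [r| |]//; rewrite ?lee_fin; last first.
  move=> _ H; case: (@no_basis_oo m); apply: H.
  by rewrite lpnorm_oo_vec2 normr0 normr1 max_l.
rewrite le_eqVlt => /orP[/eqP <- H|r1 H].
  case: (@no_basis_1 m); apply: H.
  rewrite lpnorm_vec2 ?oner_eq0// invr1 !powRr1// ?addr_ge0//.
  rewrite ger0_norm ?invr_ge0//.
  lra.
have r0 : 0 < r by exact: lt_trans r1.
(* The two entries must differ in size: (1, 1) and (1, -1) satisfy both orthogonality relations for
   every r. *)
pose y := vec2 m 1 2.
have Ny : 0 < lpnorm r%:E y.
  rewrite lpnorm_vec2 ?gt_eqF// powR_gt0// ltr_wpDr ?powR_ge0//.
  by rewrite normr1 powR1.
congr _%:E; apply: (@basis_through_eq2 m r (lpnorm r%:E y)^-1) => //.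
  by rewrite invr_gt0.
rewrite -[X in vec2 _ X]mulr1 [2 * _]mulrC -vec2Z; apply: H.
rewrite lpnormZ ?lee_fin ?ltW// gtr0_norm ?invr_gt0//.
by rewrite mulVf// gt_eqF.
Qed.

End LpNorm.

(** * The Euclidean inner product and orthonormal families *)

Section Euclid.
Context {R : realType} {n : nat}.
Implicit Types u v : 'rV[R]_n.

Definition dotrv u v : R := \sum_i u ord0 i * v ord0 i.

Lemma dotrv_mulmx u v : dotrv u v = (u *m v^T) ord0 ord0.
Proof. by rewrite mxE; apply: eq_bigr => i _; rewrite mxE. Qed.

Lemma dotrvC u v : dotrv u v = dotrv v u.
Proof. by apply: eq_bigr => i _; rewrite mulrC. Qed.

Lemma dotrv_linear u : scalar (dotrv u).
Proof.
move=> a v w; rewrite mulr_sumr -big_split; apply: eq_bigr => i _ /=.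
by rewrite !mxE; ring.
Qed.

Lemma dotrv_bilinear : bilinear_for *%R (idfun \; *%R) dotrv.
Proof.
split=> u; last exact: dotrv_linear.
by move=> a v w; rewrite ![dotrv _ u]dotrvC; exact: dotrv_linear.
Qed.

HB.instance Definition _ := bilinear_isBilinear.Build R 'rV[R]_n 'rV[R]_n R
  *%R (idfun \; *%R) dotrv dotrv_bilinear.

Lemma dotrv_hermitian u v : dotrv u v = (-1) ^+ false * idfun (dotrv v u).
Proof. by rewrite expr0 mul1r dotrvC. Qed.

HB.instance Definition _ :=
  isHermitianSesquilinear.Build R 'rV[R]_n false idfun dotrv dotrv_hermitian.

Lemma dotrv_gt0 u : u != 0 -> 0 < dotrv u u.
Proof.
move=> u0; have uu i : 0 <= u ord0 i * u ord0 i by rewrite -expr2 sqr_ge0.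
rewrite lt_def sumr_ge0// andbT; apply: contra u0 => /eqP u0.
apply/eqP/rowP => i; apply/eqP; rewrite mxE -[_ == 0]orbb -mulf_eq0.
by apply/eqP; apply: (psumr_eq0P _ u0).
Qed.

HB.instance Definition _ := isDotProduct.Build R 'rV[R]_n dotrv dotrv_gt0.

Lemma lpnorm2_sqr u : lpnorm 2%:E u ^+ 2 = dotrv u u.
Proof.
have S : \sum_i `|u ord0 i| `^ 2 = dotrv u u.
  by apply: eq_bigr => i _; rewrite powR_mulrn// real_normK ?num_real.
have D0 : 0 <= dotrv u u by rewrite -S sumr_ge0// => i _; exact: powR_ge0.
by rewrite /= S -powR_mulrn ?powR_ge0// -powRrM mulVf// powRr1.
Qed.

Lemma lpnorm2_lt u v : dotrv u u < dotrv v v ->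
  lpnorm 2%:E u < lpnorm 2%:E v.
Proof. by rewrite -!lpnorm2_sqr ltr_sqr ?nnegrE ?lpnorm_ge0. Qed.

Lemma inner_product_lpnorm2 : inner_product_norm (@lpnorm R n 2%:E).
Proof. by exists dotrv => v; exact: lpnorm2_sqr. Qed.

(** By Pythagoras, adding a nonzero vector orthogonal to a member strictly increases its length. *)
Lemma orthonormal_strongly_orthonormal (X : seq 'rV[R]_n) :
  (forall i j : 'I_(size X), dotrv X`_i X`_j = (i == j)%:R) ->
  strongly_orthonormal (lpnorm 2%:E) X.
Proof.
move=> XX; split; last first.
  move=> _ /(nthP 0)[k kX <-]; apply/eqP.
  rewrite -(@eqrXn2 _ 2)// ?lpnorm_ge0// lpnorm2_sqr expr1n.
  by rewrite (XX (Ordinal kX) (Ordinal kX)) eqxx.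
split.
  apply/(uniqP 0) => k l kX lX kl; apply/eqP.
  have := XX (Ordinal kX) (Ordinal lX); rewrite -kl.
  rewrite (XX (Ordinal kX) (Ordinal kX)) eqxx -val_eqE/=.
  by case: eqP => // _ /eqP; rewrite oner_eq0.
move=> i lam [j ji lamj].
set w := \sum_(_ < _ | _) _.
have wX (k : 'I_(size X)) :
    dotrv X`_k w = \sum_(l < size X | l != i) lam l * (k == l)%:R.
  by rewrite linear_sumr; apply: eq_bigr => l _; rewrite linearZr_LR /= XX.
have iw : dotrv X`_i w = 0.
  by rewrite wX big1// => l; rewrite eq_sym => /negPf ->; rewrite mulr0.
(* Pairing [w] with the member of index [j] recovers [lam j], which is nonzero. *)
have w0 : w != 0.
  apply: contra lamj => /eqP w0; have := wX j; rewrite w0 linear0r.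
  rewrite (bigD1 j)//= eqxx mulr1 big1 ?addr0 => [<-//|l /andP[_ lj]].
  by rewrite eq_sym (negPf lj) mulr0.
apply: (@lpnorm2_lt X`_i (X`_i + w)).
by rewrite linearDl !linearDr /= (dotrvC w) iw addr0 add0r ltrDl dotrv_gt0.
Qed.

End Euclid.

(** * Householder reflections and the basis for p = 2 *)

(** The square is 1 - 2 c M + c^2 d M. Asking for c (c d) = 2 c rather than c d = 2 admits the
    degenerate reflection c = 0. *)
Lemma reflection_mx_invol (R : comPzRingType) n (M : 'M[R]_n) (c d : R) :
  M *m M = d *: M -> c * (c * d) = c * 2 ->
  (1%:M - c *: M) *m (1%:M - c *: M) = 1%:M.
Proof.
move=> MM cd; rewrite mulmxBl !mulmxBr !mul1mx mulmx1 -scalemxAl -scalemxAr MM.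
by rewrite !scalerA -mulrA cd mulr2n mulrDr mulr1 scalerDl opprB addrK subrK.
Qed.

(* The Householder reflection exchanging e_0 and x.  For x = e_0 the division
   by zero makes it the identity. *)
Lemma orthogonal_mx_row (R : realType) n (x : 'rV[R]_n.+1) : dotrv x x = 1 ->
  exists A : 'M[R]_n.+1, A *m A^T = 1%:M /\ row ord0 A = x.
Proof.
move=> xx; pose e : 'rV[R]_n.+1 := delta_mx 0 0.
have [v vE] : exists v : 'rV[R]_n.+1, v = x - e by exists (x - e).
pose c := 2 / dotrv v v.
pose A := 1%:M - c *: (v^T *m v).
have eu u : dotrv e u = u ord0 ord0.
  rewrite /dotrv (bigD1 ord0)//= big1 => [|i i0].
    by rewrite !mxE ?eqxx ?mul1r ?addr0.
  by rewrite !mxE (negPf i0) mul0r.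
have AT : A^T = A.
  by rewrite /A linearB/= linearZ/= trmx1 trmx_mul trmxK.
have vv : v *m v^T = (dotrv v v)%:M.
  by rewrite [LHS]mx11_scalar dotrv_mulmx.
have cc : c * (c * dotrv v v) = c * 2.
  rewrite /c; have [->|d0] := eqVneq (dotrv v v) 0.
    by rewrite invr0 mulr0 !mul0r.
  by rewrite divfK.
exists A; split.
  rewrite AT; apply: (@reflection_mx_invol _ _ _ _ (dotrv v v)) => //.
  by rewrite mulmxA -[v^T *m v *m v^T]mulmxA vv mul_mx_scalar scalemxAl.
have rowA : row ord0 A = e - (c * v ord0 ord0) *: v.
  by apply/rowP => j; rewrite !mxE big_ord1 !mxE eqxx [j == 0]eq_sym; ring.
rewrite rowA.
have [x_e|xe] := eqVneq x e; first by rewrite vE x_e subrr scaler0 subr0.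
(* Since [x] and [e] are unit vectors, the left side is 2 - 2 x_0, and v_0 = x_0 - 1. Hence c v_0 =
   -1 and row 0 of [A] is e + v = x. *)
have dv : dotrv v v = - 2 * v ord0 ord0.
  rewrite vE !linearDl !linearDr !linearNl !linearNr /= xx (dotrvC x) !eu.
  by rewrite !mxE !eqxx /=; ring.
have v0 : dotrv v v != 0 by rewrite gt_eqF// dotrv_gt0// vE subr_eq0.
have -> : c * v ord0 ord0 = -1.
  have w0 : v ord0 ord0 != 0.
    by apply: contraNneq v0; rewrite dv => ->; rewrite mulr0.
  by rewrite /c dv; field.
by rewrite scaleN1r opprK vE addrC subrK.
Qed.

Lemma orthonormal_basis_through (R : realType) m (x : 'rV[R]_m.+2) :
  dotrv x x = 1 -> basis_through 2%:E x.
Proof.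
move=> /orthogonal_mx_row[A [AAT xA]].
have rowA i j : dotrv (row i A) (row j A) = (i == j)%:R.
  have /matrixP/(_ i j) := AAT; rewrite !mxE => <-.
  by apply: eq_bigr => k _; rewrite !mxE.
pose X := [seq row i A | i <- enum 'I_m.+2].
have sX : size X = m.+2 by rewrite size_map size_enum_ord.
have XE (i : 'I_(size X)) : X`_i = row (cast_ord sX i) A.
  have im : (i < m.+2)%N := ltn_ord (cast_ord sX i).
  rewrite (nth_map ord0) ?size_enum_ord//; congr row.
  by apply: val_inj; rewrite /= nth_enum_ord.
have mX i : row i A \in X by apply: map_f; rewrite mem_enum.
exists X; split; last by rewrite -xA.
split; last first.
  apply: orthonormal_strongly_orthonormal => i j.
  by rewrite !XE rowA.
rewrite basisEdim sX dimvf [dim _]mul1n leqnn andbT.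
apply/subvP => v _.
(* The rows span because v = v A^T A; having the right number, they form a basis. *)
have -> : v = \sum_i (v *m A^T) ord0 i *: row i A.
  by rewrite -mulmx_sum_row -mulmxA (mulmx1C AAT) mulmx1.
by apply: memv_suml => i _; apply/memvZ/memv_span.
Qed.

Theorem theorem2p6 (R : realType) (n : nat) (p : \bar R)
    (hn : (2 <= n)%N) (hp : (1 <= p)%E) :
  (inner_product_norm (@lpnorm R n p) <-> p = 2%:E) /\
  (inner_product_norm (@lpnorm R n p) <->
   forall x : 'rV[R]_n, lpnorm p x = 1 ->
     exists X : seq 'rV[R]_n,
       strongly_orthonormal_Hamel_basis (@lpnorm R n p) X /\ x \in X).
Proof.
have ip2 : inner_product_norm (@lpnorm R n p) <-> p = 2%:E.
  split; last by move=> ->; exact: inner_product_lpnorm2.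
  by case: n hn => [|[|m]]// _; exact: inner_product_lpnorm_eq2.
split; rewrite // {}ip2.
case: n hn => [|[|m]]// _; split; last exact: basis_through_unit_eq2.
move=> -> x x1; apply: orthonormal_basis_through.
by rewrite -lpnorm2_sqr x1 expr1n.
Qed.
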